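(* Let $G$ and $H$ be non-trivial groups, let $H$ act faithfully on a set $X$, and assume that $H_X$ is of torsion-type. (i) If $H$ is FIG and $G$ is IG, then $G\wr_X H$ is IG. (ii) If $H$ is FIG or IG and $G$ is $\neg$IG, then $G\wr_X H$ is $\neg$IG.
   Context: A subset $S$ of a group $K$ invariably generates $K$ if for every choice of elements $a_s\in K$ ($s\in S$) one has $\langle a_s^{-1}sa_s : s\in S\rangle=K$. A group is FIG (finitely invariably generated) if it has a finite invariable generating set. A group is IG if it has an invariable generating set but no finite one (so IG excludes FIG). A group is $\neg$IG if it has no invariable generating set, equivalently if the group itself is not an invariable generating set. For non-trivial groups $G,H$ with $H$ acting faithfully (on the right) on a set $X$, the (restricted) wreath product is $G\wr_X H=\left(\bigoplus_{x\in X}G_x\right)\rtimes H$, where each $G_x$ is a copy of $G$, $g^{(x)}$ denotes the element $g\in G$ in $G_x$, and $h^{-1}g^{(x)}h=g^{(xh)}$ for $h\in H$. $H_X\le \mathrm{Sym}(X)$ denotes $H$ together with its faithful action on $X$, and $yH_X$ is the orbit of $y\in X$. $H_X$ is of torsion-type if there exists $y\in X$ such that for all $x\in yH_X$ and all $k\in H_X$, the set $x\langle k\rangle$ is finite. *)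

(* Defs.v *)
From HB Require Import structures.
From mathcomp Require Import all_boot.
From mathcomp Require Import boolp classical_sets functions cardinality.

Set Implicit Arguments.
Unset Strict Implicit.
Unset Printing Implicit Defensive.

Local Open Scope classical_set_scope.
Local Open Scope group_scope.

Definition nontrivial (K : groupType) : Prop := exists g : K, g <> 1.

Definition generated (K : groupType) (A : set K) : set K :=
  smallest [set S : set K | group_closed [in S]] A.

(* Only the values of [a] on [S] matter, so total functions [a : K -> K] give
   exactly the families of conjugators indexed by [S]. *)
Definition inv_generates (K : groupType) (S : set K) : Prop :=
  forall a : K -> K, generated [set s ^ a s | s in S] = [set: K].

Definition FIG (K : groupType) : Prop :=
  exists S : set K, finite_set S /\ inv_generates S.

Definition IG (K : groupType) : Prop :=
  (exists S : set K, inv_generates S) /\ ~ FIG K.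

Definition notIG (K : groupType) : Prop :=
  ~ exists S : set K, inv_generates S.

Record right_action (H : groupType) (X : Type) := RightAction {
  ract :> X -> H -> X;
  ract1 : forall x, ract x 1 = x;
  ractM : forall x h k, ract x (h * k) = ract (ract x h) k }.

Definition faithful (H : groupType) (X : Type) (to : right_action H X) : Prop :=
  forall h, (forall x, to x h = x) -> h = 1.

Definition orbit (H : groupType) (X : Type) (to : right_action H X)
  (x : X) (K : set H) : set X := [set to x k | k in K].

Definition torsion_type (H : groupType) (X : Type) (to : right_action H X) :
    Prop :=
  exists y : X, forall x, orbit to y [set: H] x ->
    forall k : H, finite_set (orbit to x (generated [set k])).

(* [Wreath f h] is the product, in this order, of the element [f] of the
   direct sum and of [h]. The fields do not mention the action; it is a
   parameter because the group structure depends on it. *)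
Record wreath (G H : groupType) (X : Type) (to : right_action H X) := Wreath {
  wbase : X -> G;
  wtop : H;
  wbase_fin : finite_set [set x | wbase x <> 1] }.

Arguments wreath G {H X} to.
Arguments Wreath {G H X to} wbase wtop wbase_fin.

Section Wreath.
Variables (G H : groupType) (X : Type) (to : right_action H X).
Local Notation wreath := (wreath G to).

Lemma wreath_eq (u v : wreath) :
  (forall x, wbase u x = wbase v x) -> wtop u = wtop v -> u = v.
Proof.
case: u v => [f h Pf] [f' h' Pf'] /= ff' hh'; move/funext in ff'; subst f' h'.
by rewrite (Prop_irrelevance Pf Pf').
Qed.

HB.instance Definition _ := gen_eqMixin wreath.
HB.instance Definition _ := gen_choiceMixin wreath.

Lemma wshift_fin (f : X -> G) (h : H) :
  finite_set [set x | f x <> 1] -> finite_set [set x | f (to x h) <> 1].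
Proof.
move=> fin_f; apply: sub_finite_set (finite_image (to^~ h^-1) fin_f).
by move=> x /= fx; exists (to x h) => //; rewrite -ractM mulgV ract1.
Qed.

Lemma wone_fin : finite_set [set x : X | (1 : G) <> 1].
Proof. by apply: sub_finite_set (finite_set0 X) => x /=; apply. Qed.

Lemma wmul_fin (u v : wreath) :
  finite_set [set x | wbase u x * wbase v (to x (wtop u)) <> 1].
Proof.
have Uf : finite_set ([set x | wbase u x <> 1] `|`
                      [set x | wbase v (to x (wtop u)) <> 1]).
  by rewrite finite_setU; split; [|apply: wshift_fin]; apply: wbase_fin.
apply: sub_finite_set Uf => x /=.
have [->|/eqP] := eqVneq (wbase u x) 1; last by left.
by rewrite mul1g; right.
Qed.

Lemma winv_fin (u : wreath) :
  finite_set [set x | (wbase u (to x (wtop u)^-1))^-1 <> 1].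
Proof.
apply: sub_finite_set (wshift_fin (wtop u)^-1 (wbase_fin u)) => x /= nz e.
by apply: nz; rewrite e invg1.
Qed.

Definition wone : wreath := Wreath (fun=> 1) 1 wone_fin.

(* f h f' h' = (f (h f' h^-1)) (h h'), where h f' h^-1 takes the value
   f' (x h) at x because h g^(x h) h^-1 = g^(x). *)
Definition wmul (u v : wreath) : wreath :=
  Wreath (fun x => wbase u x * wbase v (to x (wtop u))) (wtop u * wtop v)
    (wmul_fin u v).

Definition winv (u : wreath) : wreath :=
  Wreath (fun x => (wbase u (to x (wtop u)^-1))^-1) (wtop u)^-1 (winv_fin u).

Lemma wmulA : associative wmul.
Proof. by move=> u v w; apply: wreath_eq => [x|] /=; rewrite ?ractM mulgA. Qed.

Lemma wmul1 : left_id wone wmul.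
Proof. by move=> u; apply: wreath_eq => [x|] /=; rewrite ?ract1 mul1g. Qed.

Lemma wmulr1 : right_id wone wmul.
Proof. by move=> u; apply: wreath_eq => [x|] /=; rewrite mulg1. Qed.

Lemma wmulV : left_inverse wone winv wmul.
Proof. by move=> u; apply: wreath_eq => [x|] /=; rewrite mulVg. Qed.

Lemma wmulrV : right_inverse wone winv wmul.
Proof.
by move=> u; apply: wreath_eq => [x|] /=; rewrite -?ractM mulgV ?ract1 ?mulgV.
Qed.

HB.instance Definition _ :=
  isGroup.Build wreath wmulA wmul1 wmulr1 wmulV wmulrV.

Lemma wcoord_fin (x : X) (g : G) :
  finite_set [set z | (if `[< z = x >] then g else 1) <> 1].
Proof.
by apply: sub_finite_set (finite_set1 x) => z /=; case: asboolP.
Qed.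

Definition wcoord (x : X) (g : G) : wreath :=
  Wreath (fun z => if `[< z = x >] then g else 1) 1 (wcoord_fin x g).
Definition wact (h : H) : wreath := Wreath (fun=> 1) h wone_fin.

Lemma wcoordJ (x : X) (g : G) (h : H) :
  wcoord x g ^ wact h = wcoord (to x h) g.
Proof.
apply: wreath_eq => [z|] /=; last by rewrite mul1g mulVg.
rewrite invg1 mul1g mulg1.
have -> // : `[< to z h^-1 = x >] = `[< z = to x h >].
apply/asboolP/asboolP => [<-|->]; first by rewrite -ractM mulVg ract1.
by rewrite -ractM mulgV ract1.
Qed.

End Wreath.

Arguments wcoord {G H X} to x g.
Arguments wact G {H X} to h.

(* Main.v *)
Require Import Defs.
From mathcomp Require Import all_boot.
From mathcomp Require Import boolp classical_sets cardinality.

(** The two parts follow from two statements about [W = wreath G to].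

    Upward ([inv_generated_wreath]): if [G] and [H] have invariable generating
    sets, so has [W]. A group has an invariable generating set exactly when no
    proper subgroup meets all its conjugacy classes
    ([inv_generatedP]). A subgroup [L] of [W] that meets every class projects
    onto a subgroup of [H] with the same property, hence onto [H]. For each
    [x] and [g], it also contains a conjugate of [wcoord x g]; as [L] projects
    onto [H], that conjugate can be brought back to the coordinate [x] inside
    [L]. So the trace of [L] on the copy of [G] at [x] meets all classes of
    [G], hence is everything: [L] contains the base group and is all of [W].

    Downward ([return_products_inv_generates]): let [y] witness torsion type,
    and let [S] invariably generate [W]. For [s = f h] in [S] and [x] in the
    orbit of [y], the cycle [x, x h, x h^2, ...] closes up after some [n]
    steps, and [f x * f (x h) * ... * f (x h^(n-1))] is the value at [x] of
    the base part of [s ^+ n]. These values invariably generate [G]. Indeed,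
    if suitable conjugates of them lie in a subgroup [M], one conjugates [s] by
    an element of the base group that moves the whole product of each cycle to
    one edge of that cycle and then conjugates it into [M]; all the conjugates
    so obtained have their base parts [M]-valued on the orbit of [y], and such
    elements form a subgroup of [W], which is proper unless [M = G]. The
    cycles that meet the support of [f] are finite in number and finite, so
    only finitely many points lie on them; hence the conjugator is finitely
    supported and each [s] contributes only finitely many values. The latter
    makes [G] FIG when [W] is.

    The existence half of (i) is the upward statement; its other half and (ii)
    follow from the downward one by contraposition. *)

Set Implicit Arguments.
Unset Strict Implicit.
Unset Printing Implicit Defensive.

Local Open Scope classical_set_scope.
Local Open Scope group_scope.

(** * Generated subgroups and invariable generation *)

Section Generation.
Variable K : groupType.
Implicit Types (A L S : set K).

Lemma group_closedP L :
  group_closed [in L] <-> L 1 /\ forall u v, L u -> L v -> L (u * v^-1).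
Proof.
split=> -[L1 LB]; split; try by rewrite ?inE in L1 *.
  by move=> u v Lu Lv; have := LB u v; rewrite !inE; apply.
by move=> u v; rewrite !inE; apply: LB.
Qed.

Lemma group_closed_mulP L : group_closed [in L] ->
  [/\ L 1, forall u, L u -> L u^-1 & forall u v, L u -> L v -> L (u * v)].
Proof.
move=> /group_closedP[L1 LB].
have LV u : L u -> L u^-1 by move=> Lu; rewrite -[u^-1]mul1g; apply: LB.
by split=> // u v Lu Lv; rewrite -[v]invgK; apply: LB => //; apply: LV.
Qed.

Lemma generated_closed A : group_closed [in generated A].
Proof.
apply/group_closedP; split=> [L [/group_closedP[]]//|u v gu gv L LA].
by have [/group_closedP[_ LB] _] := LA; apply: LB; [apply: gu|apply: gv].
Qed.

Lemma generated_min A L :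
  group_closed [in L] -> A `<=` L -> generated A `<=` L.
Proof. exact: smallest_sub. Qed.

Lemma generated_expg A g n : A g -> generated A (g ^+ n).
Proof.
move=> Ag; have [g1 _ gM] := group_closed_mulP (generated_closed A).
elim: n => [|n IHn]; first by rewrite expg0.
by rewrite expgS; apply: gM => //; apply: sub_gen_smallest.
Qed.

Lemma inv_generatedP : (exists S, inv_generates S) <->
  (forall L, group_closed [in L] -> (forall g, exists a, L (g ^ a)) ->
   forall g, L g).
Proof.
split=> [[S genS] L Lgrp Lmeets g|noL].
  have [a La] := choice Lmeets.
  have : generated [set s ^ a s | s in S] g by rewrite genS.
  by apply: generated_min => // _ [s _ <-].
exists [set: K] => a; rewrite -subTset => g _.
apply: noL g => [|g]; first exact: generated_closed.
by exists (a g); apply: sub_gen_smallest; exists g.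
Qed.

End Generation.

(** * Wreath products of invariably generated groups *)

Section Upward.
Variables (G H : groupType) (X : Type) (to : right_action H X).
Implicit Types (L : set (wreath G to)) (w : wreath G to).

Lemma wcoord_conj x (g : G) w :
  wcoord to x g ^ w = wcoord to (to x (wtop w)) (g ^ wbase w x).
Proof.
apply: wreath_eq => [z|] /=; last by rewrite mul1g mulVg.
have [->|nzx] := pselect (z = to x (wtop w)).
  by rewrite -ractM mulgV !ract1; do 2!case: asboolP => //.
case: asboolP => [zx|_]; last by case: asboolP => // _; rewrite ract1 mul1g mulVg.
by case: nzx; rewrite -zx -ractM mulVg ract1.
Qed.

Lemma wcoordB x (g g' : G) :
  wcoord to x (g * g'^-1) =
  wcoord to x g * (wcoord to x g')^-1 :> wreath G to.
Proof.
apply: wreath_eq => [z|] /=; last by rewrite invg1 mulg1.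
by rewrite !invg1 !ract1; case: asboolP => //; rewrite invg1 mulg1.
Qed.

(** Splitting off one coordinate at a time: the support of a base element is
    finite. *)
Lemma coords_generate_base L w : group_closed [in L] ->
  (forall x g, L (wcoord to x g)) -> wtop w = 1 -> L w.
Proof.
move=> /group_closed_mulP[L1 _ LM] Lcoord.
have /(@finite_seqP {classic X})[r wr] := wbase_fin w.
have {wr} : forall x, wbase w x <> 1 -> (x : {classic X}) \in r.
  by move=> x wx; have : [set x | wbase w x <> 1] x by []; rewrite wr.
elim: r w => [|x r IHr] w wr w1.
  suff -> : w = 1 by [].
  by apply: wreath_eq => // x; apply: contrapT => /wr.
rewrite -[w](mulVKg (wcoord to x (wbase w x))).
apply: LM => //; apply: IHr => [z|] /=; last by rewrite invg1 mul1g.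
rewrite !invg1 !ract1; case: asboolP => [->|nzx]; first by rewrite mulVg.
by rewrite invg1 mul1g => /wr; rewrite inE => /predU1P[].
Qed.

Theorem inv_generated_wreath :
  (exists S : set G, inv_generates S) -> (exists S : set H, inv_generates S) ->
  exists S : set (wreath G to), inv_generates S.
Proof.
rewrite !inv_generatedP => genG genH L Lgrp Lmeets.
have [L1 LV LM] := group_closed_mulP Lgrp.
have Ltop h : exists2 w, L w & wtop w = h.
  apply: (genH [set h | exists2 w, L w & wtop w = h]) => [|{}h].
    apply/group_closedP; split; first by exists 1.
    move=> _ _ [u Lu <-] [v Lv <-]; exists (u * v^-1) => //.
    by apply: LM => //; apply: LV.
  by have [a La] := Lmeets (wact G to h); exists (wtop a), (wact G to h ^ a).
have Lcoord x g : L (wcoord to x g).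
  apply: (genG [set g | L (wcoord to x g)]) => [|{}g].
    apply/group_closedP; split=> /= [|u v Lu Lv].
      suff -> : wcoord to x 1 = 1 :> wreath G to by [].
      by apply: wreath_eq => // z /=; case: asboolP.
    by rewrite wcoordB; apply: LM => //; apply: LV.
  have [a La] := Lmeets (wcoord to x g).
  (* [b] in [L] carries the coordinate [x (wtop a)] back to [x]. *)
  have [b Lb ba] := Ltop (wtop a)^-1.
  exists (wbase (a * b) x); rewrite mksetE.
  suff <- : wcoord to x g ^ (a * b) = wcoord to x (g ^ wbase (a * b) x).
    by rewrite conjgM conjgE; exact: LM (LV _ Lb) (LM _ _ La Lb).
  by rewrite wcoord_conj /= ba mulgV ract1.
move=> w; have [b Lb bw] := Ltop (wtop w).
rewrite -[w](mulgVK b); apply: LM => //.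
by apply: coords_generate_base => //=; rewrite bw mulgV.
Qed.

End Upward.

(** * Cycles of a group element *)

Section Cycles.
Variables (H : groupType) (X : Type) (to : right_action H X).
Implicit Types (h : H) (x r : X).

Definition cycle_of h x : set X := [set to x (h ^+ n) | n in [set: nat]].

Definition recurrent h x := exists2 n, 0 < n & to x (h ^+ n) = x.

(** The default [0] is a junk value, for the case where [x] is never reached. *)
Definition first_hit h r x : nat :=
  xget 0 [set n | to r (h ^+ n) = x /\
                  forall m, to r (h ^+ m) = x -> n <= m].

Lemma first_hit_eq h r x n : to r (h ^+ n) = x ->
  (forall m, to r (h ^+ m) = x -> n <= m) -> first_hit h r x = n.
Proof.
move=> rn n_min; rewrite /first_hit; case: xgetP => [_ -> [rm m_min]|/(_ n)[]//].
by apply/eqP; rewrite eqn_leq m_min // n_min.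
Qed.

Lemma first_hitP h r x : cycle_of h r x ->
  to r (h ^+ first_hit h r x) = x /\
  forall m, to r (h ^+ m) = x -> first_hit h r x <= m.
Proof.
move=> [n0 _ rn0].
have ex_n : exists n, `[< to r (h ^+ n) = x >] by exists n0; apply/asboolP.
case: (ex_minnP ex_n) => n /asboolP rn n_min.
have le_n m : to r (h ^+ m) = x -> n <= m by move=> rm; apply/n_min/asboolP.
by rewrite (first_hit_eq rn le_n).
Qed.

Lemma ract_inj h : injective (to^~ h).
Proof.
by move=> x x' /(congr1 (to^~ h^-1)); rewrite -!ractM mulgV !ract1.
Qed.

Lemma first_hit_step h r x : cycle_of h r x -> to x h <> r ->
  first_hit h r (to x h) = (first_hit h r x).+1.
Proof.
move=> /first_hitP[rx x_min] nxr; apply: first_hit_eq.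
  by rewrite expgSr ractM rx.
case=> [|m]; first by rewrite expg0 ract1 => /esym.
by rewrite expgSr ractM => /ract_inj/x_min.
Qed.

(** When the step out of [x] closes the cycle, the time from [r] to [x] is one
    less than the return time of [r], itself counted after a first step. *)
Lemma first_hit_close h r x : cycle_of h r x -> to x h = r ->
  first_hit h (to r h) r = first_hit h r x.
Proof.
move=> /first_hitP[rx x_min] xr; apply: first_hit_eq.
  by rewrite -ractM -expgS expgSr ractM rx.
move=> m; rewrite -ractM -expgS expgSr ractM -{2}xr => /ract_inj.
exact: x_min.
Qed.

Lemma finite_cycle_recurrent h x : finite_set (cycle_of h x) -> recurrent h x.
Proof.
move=> fin_hx; apply: contrapT => nrec.
have lt_neq m n : m < n -> to x (h ^+ m) <> to x (h ^+ n).
  move=> lt_mn; rewrite -(subnK (ltnW lt_mn)) expgnDr ractM => /ract_inj.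
  by move=> /esym xh; apply: nrec; exists (n - m) => //; rewrite subn_gt0.
apply: infinite_nat; rewrite (eq_finite_set (B := cycle_of h x)) //.
rewrite card_eq_sym; apply: inj_card_eq => m n _ _ eq_mn.
by have [/lt_neq|/lt_neq/nesym|] := ltngtP m n.
Qed.

Lemma cycle_of_step h x : recurrent h x -> cycle_of h (to x h) = cycle_of h x.
Proof.
move=> [[//|n] _ xn]; apply/seteqP; split=> _ [k _ <-].
  by exists k.+1; rewrite // expgS ractM.
by exists (n + k) => //; rewrite -ractM -expgS -addSn expgnDr ractM xn.
Qed.

Lemma recurrentX h x n : recurrent h x -> recurrent h (to x (h ^+ n)).
Proof.
move=> [m m_gt0 xm]; exists m => //.
by rewrite -ractM -expgnDr addnC expgnDr ractM xm.
Qed.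

Lemma cycle_of_refl h x : cycle_of h x x.
Proof. by exists 0 => //; rewrite expg0 ract1. Qed.

Lemma cycle_of_eq h x z : recurrent h x -> cycle_of h x z ->
  cycle_of h z = cycle_of h x.
Proof.
move=> rec_x [n _ <-] {z}; elim: n => [|n IHn]; first by rewrite expg0 ract1.
by rewrite expgSr ractM cycle_of_step //; apply: recurrentX.
Qed.

Lemma cycle_of_sym h x z : recurrent h x -> cycle_of h x z -> cycle_of h z x.
Proof. by move=> rec_x /(cycle_of_eq rec_x) ->; apply: cycle_of_refl. Qed.

End Cycles.

(** * Return products *)

Section Downward.
Variables (G H : groupType) (X : Type) (to : right_action H X) (y : X).
Implicit Types (h : H) (s w : wreath G to) (S : set (wreath G to)).
Local Notation O := (Defs.orbit to y [set: H]).
Hypothesis finite_cycles : forall x, O x ->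
  forall h : H, finite_set (Defs.orbit to x (generated [set h])).

Lemma orbit_ract x h : O x -> O (to x h).
Proof. by move=> [k _ <-]; exists (k * h) => //; rewrite ractM. Qed.

Lemma finite_cycle_of h x : O x -> finite_set (cycle_of to h x).
Proof.
move=> Ox; apply: sub_finite_set (finite_cycles Ox h) => _ [n _ <-].
by exists (h ^+ n) => //; apply: generated_expg.
Qed.

Lemma orbit_recurrent h x : O x -> recurrent to h x.
Proof. by move=> Ox; apply/finite_cycle_recurrent/finite_cycle_of. Qed.

Lemma wtopX w n : wtop (w ^+ n) = wtop w ^+ n.
Proof. by elim: n => [|n IHn] //; rewrite !expgS /= IHn. Qed.

Lemma wbaseXS w n x :
  wbase (w ^+ n.+1) x = wbase (w ^+ n) x * wbase w (to x (wtop w ^+ n)).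
Proof. by rewrite expgSr /= wtopX. Qed.

(** The product of the values of [wbase s] once around the cycle of [x]: the
    exponent is the first return time of [x]. *)
Definition return_product s x : G :=
  wbase (s ^+ (first_hit to (wtop s) (to x (wtop s)) x).+1) x.

Definition return_products S : set G :=
  [set g | exists s x, [/\ S s, O x & g = return_product s x]].

Definition active s : set X :=
  [set x | O x /\ exists2 z, cycle_of to (wtop s) x z & wbase s z <> 1].

Lemma wbaseX_inactive s x n : O x -> ~ active s x -> wbase (s ^+ n) x = 1.
Proof.
move=> Ox act; elim: n => [|n IHn]; first by rewrite expg0.
rewrite wbaseXS IHn mul1g; apply: contrapT => fx.
by apply: act; split=> //; exists (to x (wtop s ^+ n)) => //; exists n.
Qed.

Lemma finite_active s : finite_set (active s).
Proof.
have fin_supp : finite_set [set z | wbase s z <> 1 /\ O z].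
  by apply: sub_finite_set (wbase_fin s) => z [].
apply: (@sub_finite_set _ _
  (\bigcup_(z in [set z | wbase s z <> 1 /\ O z]) cycle_of to (wtop s) z)).
  move=> x [Ox [z xz sz]]; exists z; last first.
    by apply: cycle_of_sym => //; apply: orbit_recurrent.
  by split=> //; case: xz => n _ <-; apply: orbit_ract.
by apply: bigcup_finite => // z [_ Oz]; apply: finite_cycle_of.
Qed.

Lemma finite_return_products S :
  finite_set S -> finite_set (return_products S).
Proof.
move=> finS; apply: (@sub_finite_set _ _
  ([set 1] `|` \bigcup_(s in S) [set return_product s x | x in active s])).
  move=> _ [s [x [Ss Ox ->]]].
  have [act|nact] := pselect (active s x); first by right; exists s => //; exists x.
  by left; apply: wbaseX_inactive.
rewrite finite_setU; split=> //.
by apply: bigcup_finite => // s _; apply/finite_image/finite_active.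
Qed.

(** A point of the cycle of [x] that depends on the cycle alone. *)
Definition cycle_rep h x : X := @xget {classic X} y (cycle_of to h x).

Lemma cycle_repP h x : cycle_of to h x (cycle_rep h x).
Proof. exact: (@xgetI {classic X} y _ x (cycle_of_refl to h x)). Qed.

Lemma cycle_rep_step h x : O x -> cycle_rep h (to x h) = cycle_rep h x.
Proof. by move=> Ox; rewrite /cycle_rep cycle_of_step //; apply: orbit_recurrent. Qed.

(** With [c] prescribed at the representative [r] of a cycle, this is the
    unique continuation along the cycle for which conjugating [s] by it
    trivializes [s] on every edge except the one entering [r]. *)
Definition straightener s (a : G -> G) x : G :=
  if `[< O x >] then
    let r := cycle_rep (wtop s) x in
    (wbase (s ^+ first_hit to (wtop s) r x) r)^-1 * a (return_product s r)
  else 1.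

Lemma finite_straightener s a :
  a 1 = 1 -> finite_set [set x | straightener s a x <> 1].
Proof.
move=> a1; apply: sub_finite_set (finite_active s) => x /=.
rewrite /straightener; case: asboolP => // Ox.
have xr := cycle_repP (wtop s) x; set r := cycle_rep _ _ in xr *.
have Or : O r by case: xr => n _ <-; apply: orbit_ract.
move=> cx; apply: contrapT => nact; apply: cx.
have nact_r : ~ active s r.
  move=> [_ [z rz sz]]; apply: nact; split=> //; exists z => //.
  by rewrite -(cycle_of_eq (orbit_recurrent _ Ox) xr).
by rewrite /return_product !wbaseX_inactive // a1 invg1 mulg1.
Qed.

Lemma straightener_edge s a x : O x ->
  let r := cycle_rep (wtop s) x in
  (straightener s a x)^-1 * (wbase s x * straightener s a (to x (wtop s))) =
  if `[< to x (wtop s) = r >] then return_product s r ^ a (return_product s r)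
  else 1.
Proof.
move=> Ox; have Oxh := orbit_ract (wtop s) Ox.
rewrite /straightener (asboolT Ox) (asboolT Oxh) (cycle_rep_step _ Ox) /=.
have xr := cycle_repP (wtop s) x; set r := cycle_rep _ _ in xr *.
have rx := cycle_of_sym (orbit_recurrent _ Ox) xr.
have [rnx _] := first_hitP rx.
have edge : wbase (s ^+ first_hit to (wtop s) r x) r * wbase s x =
            wbase (s ^+ (first_hit to (wtop s) r x).+1) r.
  by rewrite wbaseXS rnx.
rewrite invgM invgK -!mulgA [in X in _ * X]mulgA edge.
case: asboolP => [xhr|nxhr]; last first.
  by rewrite (first_hit_step rx nxhr) mulVKg mulVg.
have -> : first_hit to (wtop s) r (to x (wtop s)) = 0.
  by apply: first_hit_eq => //; rewrite expg0 ract1.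
by rewrite expg0 /= invg1 mul1g -(first_hit_close rx xhr) conjgE.
Qed.

Theorem return_products_inv_generates S :
  inv_generates S -> inv_generates (return_products S).
Proof.
move=> genS a; set M := generated _.
have [M1 MV MM] := group_closed_mulP (generated_closed
  [set g ^ a g | g in return_products S]).
(* Normalizing [a 1] makes straighteners trivial on inactive cycles. *)
pose a' g := if `[< g = 1 >] then 1 else a g.
have Ma g : return_products S g -> M (g ^ a' g).
  move=> Sg; rewrite /a'; case: asboolP => [->|_]; first by rewrite conj1g.
  by apply: sub_gen_smallest; exists g.
pose L := [set w : wreath G to | forall x, O x -> M (wbase w x)].
have Lgrp : group_closed [in L].
  apply/group_closedP; split=> [x _ //|u v Lu Lv x Ox] /=.
  apply: MM; first exact: Lu.
  by apply: MV; apply: Lv; do 2!apply: orbit_ract.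
have Lconj s : exists c, S s -> L (s ^ c).
  have a'1 : a' 1 = 1 by rewrite /a' asboolT.
  exists (Wreath _ 1 (finite_straightener s a'1)) => Ss x Ox.
  rewrite /= invg1 ract1 straightener_edge //; case: asboolP => // _.
  apply: Ma; exists s, (cycle_rep (wtop s) x); split=> //.
  by case: (cycle_repP (wtop s) x) => n _ <-; apply: orbit_ract.
have [b Lb] := choice Lconj.
rewrite -subTset => g _.
have : generated [set s ^ b s | s in S] (wcoord to y g) by rewrite genS.
move=> /(generated_min Lgrp) Lg.
have {}Lg : L (wcoord to y g) by apply: Lg => _ [s Ss <-]; apply: Lb.
have /Lg /= : O y by exists 1 => //; rewrite ract1.
by rewrite asboolT.
Qed.

End Downward.

Theorem theoremA (G H : groupType) (X : Type) (to : right_action H X)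
  (ntG : nontrivial G) (ntH : nontrivial H)
  (faithful_to : faithful to) (torsion_to : torsion_type to) :
  (FIG H -> IG G -> IG (wreath G to)) /\
  (FIG H \/ IG H -> notIG G -> notIG (wreath G to)).
Proof.
have [y fin_y] := torsion_to; split.
  move=> [T [_ genT]] [genG nFIG]; split.
    by apply: inv_generated_wreath => //; exists T.
  move=> [S [finS genS]]; apply: nFIG; exists (return_products y S).
  by split; [apply: finite_return_products|apply: return_products_inv_generates].
move=> _ nIG [S genS]; apply: nIG; exists (return_products y S).
exact: return_products_inv_generates.
Qed.
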